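(* Let $\eta$ be a norm on $\mathbb{R}^d$ and let $F=\{g_t:t\ge0\}$, where $g_t=\mathrm{diag}(e^{w_1t},\dots,e^{w_dt})$ and $w_1,\dots,w_d\in\mathbb{R}$ are such that $\sum_{i=1}^d w_i=0$, $w_i\ne0$ for some $i\in\{1,\dots,d\}$, and $w_i=w_j$ for some $i\ne j$. Then $\mathbb{L}^F_\eta=[0,L^F_\eta]$.
   Context: $G=\mathrm{SL}_d(\mathbb{R})$, and $X_d=\mathrm{SL}_d(\mathbb{R})/\mathrm{SL}_d(\mathbb{Z})$ is identified with the space of unimodular lattices in $\mathbb{R}^d$ via $g\,\mathrm{SL}_d(\mathbb{Z})\mapsto g\mathbb{Z}^d$. For a norm $\eta$ on $\mathbb{R}^d$ and $x\in X_d$, $\delta_\eta(x):=\inf_{\mathbf{v}\in x\setminus\{0\}}\eta(\mathbf{v})$. The dynamical Lagrange constant of $x\in X_d$ with respect to $F=\{g_t:t\ge 0\}$ and $\eta$ is $\lambda^F_\eta(x):=\liminf_{t\to\infty}\delta_\eta(g_tx)^d$. The dynamical Lagrange spectrum is $\mathbb{L}^F_\eta:=\{\lambda^F_\eta(x):x\in X_d\}$ (a bounded subset of $[0,\infty)$), and $L^F_\eta:=\sup\mathbb{L}^F_\eta$. *)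

(* Defs.v *)
From mathcomp Require Import all_boot all_order all_algebra.
From mathcomp Require Import all_classical all_reals all_analysis.

Set Implicit Arguments.
Unset Strict Implicit.
Unset Printing Implicit Defensive.

Import Order.TTheory GRing.Theory Num.Theory.
Import numFieldNormedType.Exports.

Local Open Scope classical_set_scope.
Local Open Scope ring_scope.

(* A norm as an explicit function, since the canonical norm on matrices is the
   sup norm.  Nonnegativity follows from the three axioms. *)
Record is_norm (R : realType) (d : nat) (eta : 'cV[R]_d -> R) : Prop := IsNorm {
  is_normD : forall u v, eta (u + v) <= eta u + eta v ;
  is_normZ : forall a v, eta (a *: v) = `|a| * eta v ;
  is_norm0_eq0 : forall v, eta v = 0 -> v = 0
}.

Definition integer_lattice (R : realType) (d : nat) : set 'cV[R]_d :=
  range (fun n : 'cV[int]_d => map_mx intr n).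

Definition lattice_act (R : realType) (d : nat) (g : 'M[R]_d)
    (x : set 'cV[R]_d) : set 'cV[R]_d :=
  [set g *m v | v in x].

(* X_d = SL_d(R) / SL_d(Z), each coset g SL_d(Z) being represented by the
   lattice g Z^d. *)
Definition unimodular_lattices (R : realType) (d : nat) :
    set (set 'cV[R]_d) :=
  [set lattice_act g (@integer_lattice R d) | g in [set g : 'M[R]_d | \det g = 1]].

Definition shortest_length (R : realType) (d : nat) (eta : 'cV[R]_d -> R)
    (x : set 'cV[R]_d) : R :=
  inf [set eta v | v in x `\ 0].

(* The liminf is the library's, hence extended-real valued. *)
Definition lagrange_constant (R : realType) (d : nat) (g : R -> 'M[R]_d)
    (eta : 'cV[R]_d -> R) (x : set 'cV[R]_d) : \bar R :=
  limf_einf (fun t : R => (shortest_length eta (lattice_act (g t) x) ^+ d)%:E)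
    (+oo)%R.

Definition lagrange_spectrum (R : realType) (d : nat) (g : R -> 'M[R]_d)
    (eta : 'cV[R]_d -> R) : set (\bar R) :=
  [set lagrange_constant g eta x | x in @unimodular_lattices R d].

Definition lagrange_sup (R : realType) (d : nat) (g : R -> 'M[R]_d)
    (eta : 'cV[R]_d -> R) : \bar R :=
  ereal_sup (lagrange_spectrum g eta).

Definition diag_flow (R : realType) (d : nat) (w : 'I_d -> R) (t : R) :
    'M[R]_d :=
  diag_mx (\row_(i < d) expR (w i * t)).

(* Main.v *)
(* The diagonal flow g_t commutes with a copy of SL_2(R) acting on two
   coordinates of equal weight, so lambda(c_r x) is continuous in r for every
   one-parameter group c_r in that copy.  Mahler compactness, applied to
   g_(T_m) x_m with lambda(x_m) close to the supremum, yields a lattice x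
   attaining the supremum.  By Minkowski's theorem a limit of the lattices g_t x
   contains a nonzero vector whose remaining coordinates are tiny; choosing c_r
   to contract its two-dimensional part makes lambda(c_r x) arbitrarily small,
   and the intermediate value theorem gives every value in (0, L].  The value 0
   is attained by Z^d, which has a vector contracted by g_t.

   Mahler's and Minkowski's theorems both come from Hermite reduction of the
   quadratic form |g v|^2. *)
Require Import Defs.
From mathcomp Require Import all_boot all_order all_algebra.
From mathcomp Require Import all_classical all_reals all_analysis.
From mathcomp Require Import ring lra.

Import Order.TTheory GRing.Theory Num.Theory.
Import numFieldNormedType.Exports.

Local Open Scope classical_set_scope.
Local Open Scope ring_scope.

Set Implicit Arguments.
Unset Strict Implicit.
Unset Printing Implicit Defensive.

(** * Hermite reduction of quadratic forms *)

Definition int_mx {R : pzRingType} {m n : nat} (A : 'M[int]_(m, n)) : 'M[R]_(m, n) :=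
  map_mx intr A.

Definition qform {R : pzRingType} {n : nat} (Q : 'M[R]_n) (v : 'cV[R]_n) : R :=
  (v^T *m Q *m v) 0 0.

Lemma qformM (R : comPzRingType) (m n : nat) (Q : 'M[R]_m) (A : 'M[R]_(m, n))
    (v : 'cV[R]_n) :
  qform (A^T *m Q *m A) v = qform Q (A *m v).
Proof. by rewrite /qform trmx_mul !mulmxA. Qed.

Lemma qform_gram (R : comPzRingType) (n : nat) (g : 'M[R]_n) (v : 'cV[R]_n) :
  qform (g^T *m g) v = \sum_k (g *m v) k 0 ^+ 2.
Proof.
rewrite -[g^T]mulmx1 qformM /qform mulmx1 mxE.
by apply: eq_bigr => k _; rewrite mxE expr2.
Qed.

Lemma qformZ (R : comPzRingType) (n : nat) (Q : 'M[R]_n) (a : R) (v : 'cV[R]_n) :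
  qform Q (a *: v) = a ^+ 2 * qform Q v.
Proof.
by rewrite /qform [(a *: v)^T]linearZ -!scalemxAl -scalemxAr !mxE mulrA expr2.
Qed.

Lemma qform_delta (R : pzRingType) (n : nat) (Q : 'M[R]_n) (i : 'I_n) :
  qform Q (delta_mx i 0) = Q i i.
Proof. by rewrite /qform trmx_delta -rowE -colE !mxE. Qed.

(** Completing the square in the first variable; [C - a^-1 *: (b *m b^T)] is the Schur complement of
    the corner [a]. *)
Lemma qform_block (R : fieldType) (n : nat) (a : R) (b : 'cV[R]_n) (C : 'M[R]_n)
    (k : R) (u : 'cV[R]_n) : a != 0 ->
  qform (block_mx a%:M b^T b C) (col_mx k%:M u) =
  a * (k + (b^T *m u) 0 0 / a) ^+ 2 + qform (C - a^-1 *: (b *m b^T)) u.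
Proof.
move=> a0; set x := (b^T *m u) 0 0.
have bu : b^T *m u = x%:M by rewrite [LHS]mx11_scalar.
have ub : u^T *m b = x%:M by rewrite -[RHS]tr_scalar_mx -bu trmx_mul trmxK.
rewrite /qform tr_col_mx mul_row_block mul_row_col tr_scalar_mx.
rewrite !mulmxDl mulmxBr mulmxBl -scalemxAr -scalemxAl.
rewrite [u^T *m (b *m b^T)]mulmxA ub mul_scalar_mx -!scalemxAl bu.
rewrite -(mulmxA _ b^T) bu -!scalar_mxM scale_scalar_mx !mxE !eqxx !mulr1n.
by field.
Qed.

Lemma exists_int_near (R : realType) (x : R) : exists k : int, `|k%:~R + x| <= 2^-1.
Proof.
exists (- Num.floor (x + 2^-1)).
have /andP[] := floor_itv (x + 2^-1).
by rewrite intrD intrN ler_norml; set y := _%:~R; lra.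
Qed.

Lemma int_mxM (R : pzRingType) (m n p : nat) (A : 'M[int]_(m, n)) (B : 'M[int]_(n, p)) :
  int_mx (A *m B) = int_mx A *m int_mx B :> 'M[R]_(m, p).
Proof. by rewrite /int_mx map_mxM. Qed.

Lemma int_mx_eq0 (R : numDomainType) (m n : nat) (A : 'M[int]_(m, n)) :
  (int_mx A == 0 :> 'M[R]_(m, n)) = (A == 0).
Proof.
apply/eqP/eqP => [h|->]; last by apply/matrixP => i j; rewrite !mxE.
by apply/matrixP => i j; move/matrixP/(_ i j)/eqP: h; rewrite !mxE intr_eq0 => /eqP.
Qed.

Lemma unitmx_mul_eq0 (R : comUnitRingType) (n : nat) (A : 'M[R]_n) (v : 'cV[R]_n) :
  A \in unitmx -> (A *m v == 0) = (v == 0).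
Proof.
move=> uA; apply/eqP/eqP => [h|->]; last exact: mulmx0.
by rewrite -(mulKmx uA v) h mulmx0.
Qed.

(** The Smith form of a single column has at most one nonzero entry, so only the first column of the
    left factor survives. A nonzero integer vector is thus a multiple of a member of a lattice
    basis. *)
Lemma int_column_unimodular (n : nat) (v : 'cV[int]_n.+1) :
  exists2 A : 'M[int]_n.+1, A \in unitmx & exists c : int, v = c *: col 0 A.
Proof.
have [A uA [B uB [d _ ->]]] := int_Smith_normal_form v.
exists A => //; exists (d`_0 * B 0 0).
apply/matrixP => i j; rewrite !ord1 !mxE big_ord1 !mxE (bigD1 ord0)//= !mxE big1.
  by rewrite addr0 /= mulr1n; ring.
by move=> k; rewrite -val_eqE /= => k0; rewrite !mxE (negPf k0) mulr0n mulr0.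
Qed.

(** A vector whose value is within a third of the infimum is good enough, so no attained minimum has
    to be found. Replacing it by the basis column divides the form by [c ^+ 2 >= 1], which cannot
    increase it. *)
Lemma int_approx_min (R : realType) (n : nat) (Q : 'M[R]_n.+1) (eps : R) :
  0 < eps ->
  (forall v : 'cV[int]_n.+1, v != 0 -> eps <= qform Q (int_mx v)) ->
  exists2 A : 'M[int]_n.+1, A \in unitmx & exists2 m : R,
    qform Q (int_mx (col 0 A)) < 4 / 3 * m &
    forall v : 'cV[int]_n.+1, v != 0 -> m <= qform Q (int_mx v).
Proof.
move=> eps0 Qeps; pose E := [set qform Q (int_mx v) | v in [set v : 'cV[int]_n.+1 | v != 0]].
have lbE : lbound E eps by move=> _ [v /= v0 <-]; exact: Qeps.
have E0 : E !=set0.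
  exists (qform Q (int_mx (const_mx 1))), (const_mx 1) => //=.
  by apply/eqP => /matrixP/(_ 0 0); rewrite !mxE.
have infE : has_inf E by split=> //; exists eps.
have m0 : 0 < inf E by apply: (lt_le_trans eps0); apply: lb_le_inf.
have [_ [v /= v0 <-] vE] := inf_adherent (divr_gt0 m0 (ltr0n R 3)) infE.
have [A uA [c vA]] := int_column_unimodular v.
exists A => //; exists (inf E); last first.
  by move=> u u0; apply: ge_inf; [exists eps | exists u].
have c0 : c != 0 by apply: contraNneq v0 => c0; rewrite vA c0 scale0r.
have A0 : col 0 A != 0 by apply: contraNneq v0 => A0; rewrite vA A0 scaler0.
apply: (@le_lt_trans _ _ (qform Q (int_mx v))); last by lra.
rewrite vA; have -> : int_mx (c *: col 0 A) = c%:~R *: int_mx (col 0 A) :> 'cV[R]_n.+1.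
  by apply/matrixP => i j; rewrite !mxE intrM.
rewrite qformZ ler_peMl//; first by rewrite (le_trans _ (Qeps _ A0))// ltW.
by rewrite -rmorphXn /= ler1z -gtz0_ge1 exprn_even_gt0.
Qed.

Lemma int_unitmx_det_sqr (n : nat) (A : 'M[int]_n) : A \in unitmx -> \det A ^+ 2 = 1.
Proof. by rewrite unitmxE => /pred2P[] ->. Qed.

Lemma unitmx_col_neq0 (n : nat) (A : 'M[int]_n) (j : 'I_n) :
  A \in unitmx -> col j A != 0.
Proof.
apply: contraTneq => A0; rewrite unitmxE (expand_det_col A j) big1// => i _.
by move/matrixP/(_ i 0): A0; rewrite !mxE => ->; rewrite mul0r.
Qed.

Lemma col_mx1_0 (R : pzRingType) (n : nat) :
  col 0 (col_mx 1%:M 0) = delta_mx (lshift n 0) 0 :> 'cV[R]_(1 + n).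
Proof.
apply/matrixP => x y; rewrite [LHS]mxE [RHS]mxE !ord1 andbT.
case: (split_ordP x) => z ->; first by rewrite col_mxEu !ord1 mxE eqxx.
by rewrite col_mxEd mxE.
Qed.

(* Hermite reduction: clearing an approximate minimum of Q leaves a Schur
   complement in one variable less, which is again bounded below. *)
Lemma hermite_reduction (R : realType) (n : nat) (eps D : R) : 0 < eps -> 0 <= D ->
  exists C : R, forall Q : 'M[R]_n.+1, Q^T = Q ->
    (forall v : 'cV[int]_n.+1, v != 0 -> eps <= qform Q (int_mx v)) ->
    \det Q <= D ->
    exists2 A : 'M[int]_n.+1, A \in unitmx &
      forall j, qform Q (int_mx (col j A)) <= C.
Proof.
elim: n => [|n IHn] in eps D *.
  move=> eps0 D0; exists D => Q _ _ detQ; exists 1%:M; first exact: unitmx1.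
  move=> j; rewrite !ord1 (_ : int_mx _ = 1%:M); last first.
    by apply/matrixP => i k; rewrite !ord1 !mxE.
  by rewrite /qform trmx1 mul1mx mulmx1 -det_mx11.
move=> eps0 D0.
(* The Schur complement [S] below has determinant [\det Q / a] and is at least [a / 2] on nonzero
   integer vectors, where [a >= eps]; hence the parameters [eps / 2] and [D / eps]. *)
have [C HC] := IHn _ (D / eps) (divr_gt0 eps0 (ltr0n R 2)) (divr_ge0 D0 (ltW eps0)).
exists (2 * C) => Q symQ Qeps detQ.
have [A uA [m Am mQ]] := int_approx_min eps0 Qeps.
pose Q1 : 'M[R]_(1 + n.+1) := (int_mx A)^T *m Q *m int_mx A.
have qQ1 v : qform Q1 (int_mx v) = qform Q (int_mx (A *m v)).
  by rewrite /Q1 (qformM Q (int_mx A)) int_mxM.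
have symQ1 : Q1^T = Q1 by rewrite /Q1 !trmx_mul trmxK symQ mulmxA.
have detA : \det (int_mx A : 'M[R]_n.+2) ^+ 2 = 1.
  by rewrite det_map_mx -rmorphXn /= int_unitmx_det_sqr ?rmorph1.
have detQ1 : \det Q1 = \det Q.
  by rewrite /Q1 !det_mulmx det_tr mulrAC -expr2 detA mul1r.
clearbody Q1; pose a := Q1 0 0; pose b : 'cV[R]_n.+1 := dlsubmx Q1.
have Q1E : Q1 = block_mx a%:M b^T b (drsubmx Q1).
  rewrite -[LHS]submxK; congr block_mx; last by rewrite /b -[in RHS]symQ1 -trmx_ursub trmxK.
  by rewrite [LHS]mx11_scalar !mxE /a; congr (Q1 _ _)%:M; exact: val_inj.
move: (drsubmx Q1) Q1E => B Q1E.
have aE : a = qform Q (int_mx (col 0 A)).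
  by rewrite colE -qQ1 /int_mx map_delta_mx qform_delta.
have a_ge : eps <= a.
  by rewrite aE; apply: Qeps; exact: unitmx_col_neq0.
have a0 : 0 < a by exact: lt_le_trans a_ge.
have am : a < 4 / 3 * m by rewrite aE.
pose S := B - a^-1 *: (b *m b^T).
(* Rounding the first coordinate leaves at most [a / 4] from the completed square. *)
have step (u : 'cV[int]_n.+1) : exists k : int,
    qform Q1 (int_mx (col_mx k%:M u)) <= a / 4 + qform S (int_mx u).
  have [k kx] := exists_int_near ((b^T *m int_mx u) 0 0 / a).
  exists k; rewrite /int_mx map_col_mx map_scalar_mx /= Q1E qform_block ?gt_eqF//.
  rewrite lerD2r ler_pM2l//; move: kx; rewrite /int_mx ler_norml.
  by set x := _ + _; nra.
(* The lifted vector has value at least [m > 3 * a / 4], and removing [a / 4] leaves [a / 2]; the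
   factor [4 / 3] is chosen for this. *)
have S_ge (u : 'cV[int]_n.+1) : u != 0 -> a / 2 <= qform S (int_mx u).
  move=> u0; have [k] := step u; rewrite qQ1.
  have /mQ : A *m col_mx k%:M u != 0.
    rewrite unitmx_mul_eq0//.
    have : (col_mx k%:M u : 'cV_(1 + n.+1)) != 0 by rewrite col_mx_eq0 negb_and u0 orbT.
    exact.
  lra.
have detS : \det S <= D / eps.
  have -> : \det S = \det Q / a.
    rewrite -detQ1.
    have -> : Q1 = block_mx 1%:M 0 (a^-1 *: b) 1%:M *m block_mx a%:M b^T 0 S.
      rewrite mulmx_block !mul1mx !mul0mx !addr0 mul_mx_scalar scalerA.
      by rewrite mulfV ?gt_eqF// scale1r /S -scalemxAl addrC subrK -Q1E.
    rewrite det_mulmx det_lblock det_ublock !det1 !mul1r det_scalar1.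
    by rewrite mulrAC mulfV ?gt_eqF// mul1r.
  apply: (@le_trans _ _ (D / a)); first by rewrite ler_pM2r ?invr_gt0.
  by rewrite ler_wpM2l// lef_pV2 ?posrE.
have symS : S^T = S.
  rewrite /S linearB linearZ /= trmx_mul trmxK; congr (_ - _).
  by move: symQ1; rewrite Q1E tr_block_mx => /eq_block_mx[].
have S_eps (u : 'cV[int]_n.+1) : u != 0 -> eps / 2 <= qform S (int_mx u).
  by move=> /S_ge; lra.
have [A' uA' A'C] := HC S symS S_eps detS.
have C_ge : a / 2 <= C.
  by apply: le_trans (A'C 0); apply: S_ge; exact: unitmx_col_neq0.
have [k kP] := choice (fun j => step (col j A')).
(* The new basis consists of the first unit vector, of value [a], and of the columns of [A'] lifted
   by their rounded coordinates, of value at most [a / 4 + C]. Since [a <= 2 * C], both are at most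
   [2 * C]. *)
pose K : 'rV_n.+1 := \row_(j < n.+1) (k j).
pose M : 'M[int]_(1 + n.+1) := block_mx 1%:M K 0 A'.
have uM : M \in unitmx by rewrite unitmxE det_ublock det1 mul1r -unitmxE.
suff MC (j : 'I_(1 + n.+1)) : qform Q1 (int_mx (col j M)) <= 2 * C.
  exists (A *m M); last by move=> j; rewrite colE -mulmxA -colE -qQ1; exact: MC.
  by rewrite unitmx_mul uA; exact: uM.
rewrite /M block_mxEh.
case: (split_ordP j) => j' ->.
  rewrite colKl ord1 (_ : col 0 _ = delta_mx (lshift n.+1 0) 0); last exact: col_mx1_0.
  rewrite /int_mx map_delta_mx qform_delta.
  have -> : lshift n.+1 0 = 0 :> 'I_(1 + n.+1) by exact: val_inj.
  by rewrite -/a; lra.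
rewrite colKr col_col_mx (_ : col j' K = (k j')%:M); last first.
  by apply/matrixP => x y; rewrite !ord1 !mxE eqxx.
have := kP j'; have := A'C j'; lra.
Qed.

(** * Minkowski and Mahler bounds from Hermite reduction *)

Lemma sum_sqr_ge (R : realDomainType) (n : nat) (x : 'cV[R]_n) (k : 'I_n) :
  x k 0 ^+ 2 <= \sum_j x j 0 ^+ 2.
Proof. by rewrite (bigD1 k)//= lerDl sumr_ge0// => j _; exact: sqr_ge0. Qed.

Lemma det_gram (R : comPzRingType) (n : nat) (g : 'M[R]_n) :
  \det g = 1 -> \det (g^T *m g) = 1.
Proof. by move=> g1; rewrite det_mulmx det_tr g1 mulr1. Qed.

Lemma normr_le_sqr (R : realDomainType) (x C : R) : x ^+ 2 <= C -> `|x| <= C + 1.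
Proof. by move=> xC; rewrite ler_norml; nra. Qed.

(** Either some nonzero integer vector has Gram value at most 1, or the Gram form is bounded below
    by 1 and Hermite reduction applies with both parameters equal to 1; any reduced column then
    serves. *)
Lemma minkowski_short_vector (R : realType) (n : nat) : exists C : R,
  forall g : 'M[R]_n.+1, \det g = 1 ->
  exists2 v : 'cV[int]_n.+1, v != 0 & forall k, `|(g *m int_mx v) k 0| <= C.
Proof.
have [C HC] := @hermite_reduction R n 1 1 ltr01 ler01.
exists (Num.max C 1 + 1) => g g1.
pose q v := qform (g^T *m g) (int_mx v : 'cV[R]_n.+1).
suff [v v0 qv] : exists2 v : 'cV[int]_n.+1, v != 0 & q v <= Num.max C 1.
  exists v => // k; apply: normr_le_sqr; apply: le_trans qv.
  by rewrite /q qform_gram; exact: sum_sqr_ge.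
have [[v [v0 qv]]|noq] := pselect (exists v : 'cV[int]_n.+1, v != 0 /\ q v <= 1).
  by exists v; rewrite // le_max qv orbT.
have q1 (v : 'cV[int]_n.+1) : v != 0 -> 1 <= q v.
  by move=> v0; rewrite leNgt; apply/negP => qv; apply: noq; exists v; split=> //; exact: ltW.
have [||A uA AC] := HC (g^T *m g) _ q1; first by rewrite trmx_mul trmxK.
  by rewrite det_gram.
by exists (col 0 A); [exact: unitmx_col_neq0 | rewrite le_max AC].
Qed.

(** An entry of size [tau] forces the Gram form to be at least [tau ^+ 2], so Hermite reduction
    bounds a whole basis. *)
Lemma mahler_bounded_basis (R : realType) (n : nat) (tau : R) : 0 < tau ->
  exists C : R, forall g : 'M[R]_n.+1, \det g = 1 ->
    (forall v : 'cV[int]_n.+1, v != 0 -> exists k, tau <= `|(g *m int_mx v) k 0|) ->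
    exists2 A : 'M[int]_n.+1, \det A = 1 & forall i j, `|(g *m int_mx A) i j| <= C.
Proof.
move=> tau0.
have [C HC] := @hermite_reduction R n (tau ^+ 2) 1 (exprn_gt0 2 tau0) ler01.
exists (C + 1) => g g1 gtau.
have [|v v0||A uA AC] := HC (g^T *m g); first by rewrite trmx_mul trmxK.
- rewrite qform_gram; have [k kt] := gtau _ v0.
  apply: le_trans (sum_sqr_ge _ k).
  by rewrite -[leRHS]real_normK ?num_real// lerXn2r ?nnegrE// ltW.
- by rewrite det_gram.
(* The reduced basis has determinant 1 or -1; multiplying its first column by [\det A] corrects the
   sign without changing absolute values. *)
pose s : 'rV[int]_n.+1 := \row_j (if j == 0 then \det A else 1).
have s2 j : s 0 j ^+ 2 = 1.
  by rewrite mxE; case: ifP => _; rewrite ?expr1n ?int_unitmx_det_sqr.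
exists (A *m diag_mx s).
  rewrite det_mulmx det_diag big_ord_recl big1 => [|i _]; last by rewrite mxE.
  by rewrite mxE eqxx mulr1 -expr2 int_unitmx_det_sqr.
move=> i j; apply: normr_le_sqr; apply: le_trans (AC j).
have -> : (g *m int_mx (A *m diag_mx s)) i j = (g *m int_mx (col j A)) i 0 * (s 0 j)%:~R.
  rewrite mul_mx_diag !mxE mulr_suml; apply: eq_bigr => k _.
  by rewrite !mxE intrM mulrA.
rewrite exprMn -[X in _ * X]rmorphXn /= s2 mulr1 qform_gram; exact: sum_sqr_ge.
Qed.

(** * Entrywise limits and norms *)

(** Ultrafilters replace the extraction of subsequences: compactness of the segment gives a cluster
    point, and a cluster point of an ultrafilter is a limit. *)
Lemma ultra_cvg_bounded (R : realType) (T : Type) (U : set_system T)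
    (f : T -> R) (C : R) :
  UltraFilter U -> (\forall t \near U, `|f t| <= C) -> exists l : R, f @ U --> l.
Proof.
move=> UU fC; have Up : ProperFilter U by exact: ultra_proper.
have [|l [_ lU]] := @segment_compact R (- C) C (f @ U) _.
  by apply: filterS fC => t; rewrite /= in_itv /= ler_norml.
exists l => W Wl; rewrite /= /fmap /=.
have [//|nW] := @in_ultra_setVsetC _ _ (f @^-1` W) UU.
by have [x [nWx Wx]] := lU (~` W) W nW Wl.
Qed.

Definition mx_cvg {R : realType} {T : Type} {m n : nat} (F : set_system T)
    (A : T -> 'M[R]_(m, n)) (B : 'M[R]_(m, n)) : Prop :=
  forall i j, A t i j @[t --> F] --> B i j.

Section mx_cvg.
Context {R : realType} {T : Type} {F : set_system T} {FF : Filter F}.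

Lemma cvg_sumr (I : Type) (r : seq I) (f : I -> T -> R) (l : I -> R) :
  (forall i, f i @ F --> l i) -> \sum_(i <- r) f i t @[t --> F] --> \sum_(i <- r) l i.
Proof.
move=> fl; elim: r => [|i r IHr].
  by under eq_fun do rewrite big_nil; rewrite big_nil; exact: cvg_cst.
by under eq_fun do rewrite big_cons; rewrite big_cons; exact: cvgD.
Qed.

Lemma cvg_prodr (I : Type) (r : seq I) (f : I -> T -> R) (l : I -> R) :
  (forall i, f i @ F --> l i) -> \prod_(i <- r) f i t @[t --> F] --> \prod_(i <- r) l i.
Proof.
move=> fl; elim: r => [|i r IHr].
  by under eq_fun do rewrite big_nil; rewrite big_nil; exact: cvg_cst.
by under eq_fun do rewrite big_cons; rewrite big_cons; exact: cvgM.
Qed.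

Lemma cvg_exprn (k : nat) (f : T -> R) (l : R) :
  f @ F --> l -> f t ^+ k @[t --> F] --> l ^+ k.
Proof.
move=> fl; elim: k => [|k IHk]; first exact: cvg_cst.
by under eq_fun do rewrite exprS; rewrite exprS; exact: cvgM.
Qed.

Lemma mx_cvg_cst (m n : nat) (A : 'M[R]_(m, n)) : mx_cvg F (fun=> A) A.
Proof. by move=> i j; exact: cvg_cst. Qed.

Lemma mx_cvgM (m n p : nat) (A : T -> 'M[R]_(m, n)) (B : T -> 'M[R]_(n, p)) A0 B0 :
  mx_cvg F A A0 -> mx_cvg F B B0 -> mx_cvg F (fun t => A t *m B t) (A0 *m B0).
Proof.
move=> hA hB i j; under eq_fun do rewrite mxE; rewrite mxE.
by apply: cvg_sumr => k; apply: cvgM; [exact: hA | exact: hB].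
Qed.

Lemma cvg_det (n : nat) (A : T -> 'M[R]_n) A0 :
  mx_cvg F A A0 -> \det (A t) @[t --> F] --> \det A0.
Proof.
move=> hA; apply: cvg_sumr => s; apply: cvgM; first exact: cvg_cst.
by apply: cvg_prodr => i; exact: hA.
Qed.

Lemma mx_cvg_near (m n : nat) (A : T -> 'M[R]_(m, n)) A0 (e : R) :
  mx_cvg F A A0 -> 0 < e -> \forall t \near F, forall i j, `|A t i j - A0 i j| <= e.
Proof.
move=> hA e0; apply: filter_forall => i; apply: filter_forall => j.
by have /cvgrPdist_le/(_ _ e0) := hA i j; apply: filterS => t; rewrite distrC.
Qed.

End mx_cvg.

(** * Equivalence of an arbitrary norm with the sup norm *)

Section norm.
Context {R : realType} {n : nat} {eta : 'cV[R]_n.+1 -> R} (heta : is_norm eta).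

Lemma norm0 : eta 0 = 0.
Proof. by rewrite -(scale0r 0) (is_normZ heta) normr0 mul0r. Qed.

Lemma normN v : eta (- v) = eta v.
Proof. by rewrite -scaleN1r (is_normZ heta) normrN1 mul1r. Qed.

Lemma norm_ge0 v : 0 <= eta v.
Proof. by have := is_normD heta v (- v); rewrite subrr norm0 normN; lra. Qed.

Lemma norm_sum (I : Type) (r : seq I) (f : I -> 'cV[R]_n.+1) :
  eta (\sum_(i <- r) f i) <= \sum_(i <- r) eta (f i).
Proof.
elim: r => [|i r IHr]; first by rewrite !big_nil norm0.
by rewrite !big_cons; apply: le_trans (is_normD heta _ _) _; rewrite lerD2l.
Qed.

(** Expansion in the standard basis and the triangle inequality; the summand 1 makes the constant
    positive. *)
Lemma norm_le_entries : exists2 B : R, 0 < B &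
  forall (v : 'cV[R]_n.+1) (tau : R), (forall k, `|v k 0| <= tau) -> eta v <= B * tau.
Proof.
exists (1 + \sum_k eta (delta_mx k 0)).
  by apply: ltr_wpDr => //; apply: sumr_ge0 => k _; exact: norm_ge0.
move=> v tau vt; have tau0 : 0 <= tau by exact: le_trans (vt 0).
rewrite [v]matrix_sum_delta; apply: le_trans (norm_sum _ _) _.
apply: (@le_trans _ _ (\sum_k eta (delta_mx k 0) * tau)).
  apply: ler_sum => k _; rewrite big_ord1 (is_normZ heta) mulrC.
  by apply: ler_wpM2l; [exact: norm_ge0 | exact: vt].
by rewrite -mulr_suml ler_wpM2r// lerDr.
Qed.

Lemma norm_cvg (T : Type) (F : set_system T) {FF : Filter F}
    (u : T -> 'cV[R]_n.+1) (v : 'cV[R]_n.+1) :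
  mx_cvg F u v -> eta (u t) @[t --> F] --> eta v.
Proof.
move=> uv; have [B B0 HB] := norm_le_entries.
apply/cvgrPdist_le => e e0.
apply: filterS (mx_cvg_near uv (divr_gt0 e0 B0)) => t ut.
have h : eta (u t - v) <= e.
  have -> : e = B * (e / B) by rewrite mulrCA mulfV ?mulr1// gt_eqF.
  by apply: HB => k; rewrite !mxE; exact: ut.
have h1 : eta (u t) <= eta (u t - v) + eta v.
  by rewrite -[in leLHS](subrK v (u t)); exact: is_normD.
have h2 : eta v <= eta (u t - v) + eta (u t).
  by rewrite -[X in X + _]normN opprB -[in leLHS](subrK (u t) v); exact: is_normD.
rewrite ler_norml; lra.
Qed.

(** Compactness of the sup-norm sphere: otherwise vectors of sup norm 1 with [eta] tending to 0
    would converge along an ultrafilter to a vector of [eta] zero, hence to 0, although each of them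
    has an entry of absolute value 1. *)
Lemma entries_le_norm : exists2 C : R, 0 < C & forall (v : 'cV[R]_n.+1) k, `|v k 0| <= C * eta v.
Proof.
apply: contrapT => noC.
have bad (m : nat) : exists u : 'cV[R]_n.+1,
    [/\ forall k, `|u k 0| <= 1, exists k, `|u k 0| = 1 & eta u <= m.+1%:R^-1].
  have [v [k vk]] : exists (v : 'cV[R]_n.+1) k, m.+1%:R * eta v < `|v k 0|.
    apply: contrapT => nov; apply: noC; exists m.+1%:R; first by rewrite ltr0n.
    by move=> v k; rewrite leNgt; apply/negP => vk; apply: nov; exists v, k.
  pose k0 := [arg max_(i > k) `|v i 0|]%O.
  have k0P i : `|v i 0| <= `|v k0 0|.
    by rewrite /k0; case: arg_maxP => // j _; exact.
  have v0 : 0 < `|v k0 0|.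
    apply: lt_le_trans (k0P k); apply: le_lt_trans vk.
    by rewrite mulr_ge0// norm_ge0.
  exists (`|v k0 0|^-1 *: v); split.
  - by move=> i; rewrite !mxE normrM ger0_norm ?invr_ge0// ler_pdivrMl// mulr1.
  - by exists k0; rewrite !mxE normrM ger0_norm ?invr_ge0// mulVf// gt_eqF.
  rewrite (is_normZ heta) ger0_norm ?invr_ge0// ler_pdivrMl//.
  rewrite ler_pdivlMr ?ltr0n// mulrC; apply: ltW.
  exact: lt_le_trans (k0P k).
have [u uP] := choice bad.
have [U [UU oU]] := @ultraFilterLemma _ \oo _.
have Up : ProperFilter U by exact: ultra_proper.
have ex k : exists l : R, u m k 0 @[m --> U] --> l.
  by apply: (@ultra_cvg_bounded _ _ _ _ 1); apply: nearW => m; have [] := uP m.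
have [z zP] := choice ex.
pose w : 'cV[R]_n.+1 := \col_k z k.
have uw : mx_cvg U u w by move=> i j; rewrite !ord1 mxE; exact: zP.
have w0 : w = 0.
  apply: (is_norm0_eq0 heta); apply/eqP; rewrite eq_le norm_ge0 andbT.
  have h : @harmonic R @ U --> (0 : R).
    by apply: cvg_trans (@cvg_harmonic R); exact: cvg_app.
  apply: (ler_cvg_to (norm_cvg uw) h).
  by apply: nearW => m; have [] := uP m.
have [m um] := filter_ex (mx_cvg_near uw (divr_gt0 ltr01 (ltr0n R 2))).
have [_ [k uk] _] := uP m.
have := um k 0; rewrite w0 mxE subr0 uk; lra.
Qed.

End norm.

(** * Systoles and Mahler compactness *)

Lemma lattice_actM (R : realType) (d : nat) (g h : 'M[R]_d) (x : set 'cV[R]_d) :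
  lattice_act g (lattice_act h x) = lattice_act (g *m h) x.
Proof.
rewrite /lattice_act; apply/seteqP; split => [_ [_ [v xv <-] <-]|_ [v xv <-]].
  by exists v => //; rewrite mulmxA.
by exists (h *m v); [exists v | rewrite mulmxA].
Qed.

(** The function $\delta_\eta$ read on a basis matrix instead of a lattice, so that limits of
    lattices can be taken entrywise. *)
Definition systole {R : realType} {d : nat} (eta : 'cV[R]_d -> R) (g : 'M[R]_d) : R :=
  shortest_length eta (lattice_act g (@integer_lattice R d)).

Lemma det1_unitmx (R : comUnitRingType) (d : nat) (g : 'M[R]_d) :
  \det g = 1 -> g \in unitmx.
Proof. by move=> g1; rewrite unitmxE g1 unitr1. Qed.

Section systole.
Context {R : realType} {n : nat} {eta : 'cV[R]_n.+1 -> R} (heta : is_norm eta).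

Let systole_set (g : 'M[R]_n.+1) :=
  [set eta v | v in lattice_act g (@integer_lattice R n.+1) `\ 0].

Lemma systole_set_vec (g : 'M[R]_n.+1) (v : 'cV[int]_n.+1) :
  g \in unitmx -> v != 0 -> systole_set g (eta (g *m int_mx v)).
Proof.
move=> gu v0; exists (g *m int_mx v) => //; split.
  by exists (int_mx v) => //; exists v.
by apply/eqP; rewrite unitmx_mul_eq0// int_mx_eq0.
Qed.

Lemma systole_ge0 (g : 'M[R]_n.+1) : 0 <= systole eta g.
Proof.
rewrite /systole /shortest_length -/(systole_set g).
have [->|/set0P E0] := eqVneq (systole_set g) set0; first by rewrite inf0.
by apply: lb_le_inf => // _ [v _ <-]; exact: norm_ge0.
Qed.

Lemma systole_le (g : 'M[R]_n.+1) (v : 'cV[int]_n.+1) :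
  g \in unitmx -> v != 0 -> systole eta g <= eta (g *m int_mx v).
Proof.
move=> gu v0; apply: ge_inf; last exact: systole_set_vec.
by exists 0 => _ [u _ <-]; exact: norm_ge0.
Qed.

Lemma le_systole (g : 'M[R]_n.+1) (a : R) : g \in unitmx ->
  (forall v : 'cV[int]_n.+1, v != 0 -> a <= eta (g *m int_mx v)) -> a <= systole eta g.
Proof.
move=> gu ag; apply: lb_le_inf.
  exists (eta (g *m int_mx (const_mx 1))); apply: systole_set_vec => //.
  by apply/eqP => /matrixP/(_ 0 0); rewrite !mxE.
move=> _ [_ [[_ [v _ <-] <-] v0] <-]; apply: ag.
apply: contra_not_neq v0 => ->; rewrite -[map_mx _ _]/(int_mx _).
by have /eqP -> : (int_mx 0 : 'cV[R]_n.+1) == 0; rewrite ?int_mx_eq0 ?mulmx0.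
Qed.

(** The bound is applied to vectors within [harmonic m] of the infimum, and continuity of the power
    lets [m] tend to infinity. *)
Lemma le_systoleX (g : 'M[R]_n.+1) (a : R) (k : nat) : g \in unitmx ->
  (forall v : 'cV[int]_n.+1, v != 0 -> a <= eta (g *m int_mx v) ^+ k) ->
  a <= systole eta g ^+ k.
Proof.
move=> gu ag.
have h : (systole eta g + harmonic m) ^+ k @[m --> \oo] --> (systole eta g + 0) ^+ k.
  by apply: cvg_exprn; apply: cvgD; [exact: cvg_cst | exact: cvg_harmonic].
rewrite addr0 in h; apply: (ler_cvg_to (cvg_cst a) h); apply: nearW => m.
have [v v0 vm] : exists2 v : 'cV[int]_n.+1, v != 0 &
    eta (g *m int_mx v) < systole eta g + harmonic m.
  apply: contrapT => nov.
  suff : systole eta g + harmonic m <= systole eta g by rewrite gerDl leNgt harmonic_gt0.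
  apply: le_systole => // v v0; rewrite leNgt; apply/negP => vm.
  by apply: nov; exists v.
apply: le_trans (ag v v0) _; apply: lerXn2r; rewrite ?nnegrE ?norm_ge0//.
- by apply: le_trans (ltW vm); exact: norm_ge0.
- exact: ltW.
Qed.

Lemma systole_bounded : exists C : R,
  forall g : 'M[R]_n.+1, \det g = 1 -> systole eta g <= C.
Proof.
have [B _ HB] := norm_le_entries heta.
have [C HC] := @minkowski_short_vector R n.
exists (B * C) => g g1; have [v v0 vC] := HC g g1.
by apply: le_trans (systole_le (det1_unitmx g1) v0) _; exact: HB.
Qed.

(** The factor tends to 1 as [M] tends to the identity; continuity of the Lagrange constant along
    the contraction rests on this. *)
Lemma norm_mulmx_near1 : exists B : R, 0 <= B /\ forall (M : 'M[R]_n.+1) v,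
  eta (M *m v) <= (1 + B * \sum_i \sum_j `|M i j - (1%:M : 'M[R]_n.+1) i j|) * eta v.
Proof.
have [B B0 HB] := norm_le_entries heta; have [C C0 HC] := entries_le_norm heta.
exists (B * C); split=> [|M v]; first exact: ltW (mulr_gt0 B0 C0).
rewrite -[M in leLHS](subrK 1%:M M) mulmxDl mul1mx mulrDl mul1r addrC.
apply: le_trans (is_normD heta _ _) _; rewrite lerD2l -!mulrA.
apply: HB => i; rewrite mxE; apply: le_trans (ler_norm_sum _ _ _) _.
have Ce0 : 0 <= C * eta v by rewrite mulr_ge0 ?norm_ge0 ?(ltW C0).
(* Row [i] of the double sum suffices, the other rows being nonnegative. *)
rewrite mulrCA [in leRHS](bigD1 i)//= mulrDl; apply: ler_wpDr.
  by rewrite mulr_ge0//; apply: sumr_ge0 => k _; exact: sumr_ge0.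
rewrite mulr_suml; apply: ler_sum => j _.
by rewrite normrM !mxE; apply: ler_wpM2l.
Qed.

Lemma systoleM (M g : 'M[R]_n.+1) (K : R) : M \in unitmx -> g \in unitmx ->
  0 < K -> (forall v, eta (M *m v) <= K * eta v) ->
  systole eta (M *m g) <= K * systole eta g.
Proof.
move=> Mu gu K0 MK; rewrite -ler_pdivrMl//; apply: le_systole => // v v0.
rewrite ler_pdivrMl//; apply: le_trans (MK _); rewrite mulmxA; apply: systole_le => //.
by rewrite unitmx_mul Mu.
Qed.

(** A lower bound on the systole gives bases with bounded entries, which converge along the
    ultrafilter; the matrices [A t] record the change of basis. *)
Lemma mahler_compactness (T : Type) (U : set_system T) (G : T -> 'M[R]_n.+1) (e : R) :
  UltraFilter U -> 0 < e -> (forall t, \det (G t) = 1) ->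
  (\forall t \near U, e <= systole eta (G t)) ->
  exists A : T -> 'M[int]_n.+1, exists h : 'M[R]_n.+1,
    [/\ forall t, \det (A t) = 1, \det h = 1 & mx_cvg U (fun t => G t *m int_mx (A t)) h].
Proof.
move=> UU e0 G1 Ge; have Up : ProperFilter U by exact: ultra_proper.
have [B B0 HB] := norm_le_entries heta.
(* A vector with all entries below [e / (2 * B)] has norm at most [e / 2], below the assumed
   systole. *)
have [C HC] := @mahler_bounded_basis R n (e / (2 * B)) (divr_gt0 e0 (mulr_gt0 (ltr0n _ 2) B0)).
have ex t : exists A : 'M[int]_n.+1, \det A = 1 /\
    (e <= systole eta (G t) -> forall i j, `|(G t *m int_mx A) i j| <= C).
  (* Where the systole bound fails, the identity is a harmless default: the limit only sees a set of
     [U]. *)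
  have [et|] := pselect (e <= systole eta (G t)); last by exists 1%:M; rewrite det1.
  have [|A A1 AC] := HC (G t) (G1 t); last by exists A.
  move=> v v0; apply: contrapT => nok.
  have := systole_le (det1_unitmx (G1 t)) v0; apply/negP; rewrite -ltNge.
  apply: lt_le_trans et; apply: (@le_lt_trans _ _ (B * (e / (2 * B)))).
    by apply: HB => k; rewrite leNgt; apply/negP => kt; apply: nok; exists k; exact: ltW.
  by rewrite (_ : B * _ = e / 2); [lra | field; rewrite gt_eqF].
have [A AP] := choice ex.
have ex2 (ij : 'I_n.+1 * 'I_n.+1) : exists l : R,
    (G t *m int_mx (A t)) ij.1 ij.2 @[t --> U] --> l.
  by apply: (@ultra_cvg_bounded _ _ _ _ C); apply: filterS Ge => t /(proj2 (AP t)).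
have [l lP] := choice ex2.
pose h : 'M[R]_n.+1 := \matrix_(i, j) l (i, j).
have hP : mx_cvg U (fun t => G t *m int_mx (A t)) h.
  by move=> i j; rewrite mxE; exact: (lP (i, j)).
exists A, h; split=> // [t|]; first by have [] := AP t.
apply: (cvg_unique _ (cvg_det hP)) => //.
rewrite (_ : (fun t => _) = (fun=> 1)); first exact: cvg_cst.
apply/funext => t; rewrite det_mulmx G1 mul1r det_map_mx.
by have [->] := AP t; rewrite rmorph1.
Qed.

End systole.

(** * Lagrange constants *)

Section liminf.
Context {R : realType} (f : R -> R).

Lemma limf_einf_ge (a : R) :
  (\forall t \near +oo, a <= f t) -> (a%:E <= limf_einf (fun t => (f t)%:E) (+oo)%R)%E.
Proof.
move=> fa; rewrite limf_einfE; apply: le_ereal_sup_tmp.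
exists (ereal_inf ((fun t => (f t)%:E) @` [set t | a <= f t])).
  by exists [set t | a <= f t].
by apply: le_ereal_inf_tmp => _ [t at_ <-]; rewrite lee_fin.
Qed.

Lemma limf_einf_gt (a : R) :
  (a%:E < limf_einf (fun t => (f t)%:E) (+oo)%R)%E -> \forall t \near +oo, a < f t.
Proof.
rewrite limf_einfE => /ereal_sup_gt[_ [V Voo <-]] aV.
apply: filterS Voo => t Vt; rewrite -lte_fin; apply: lt_le_trans aV _.
by apply: ereal_inf_lbound; exists t.
Qed.

End liminf.

Lemma det_diag_flow (R : realType) (d : nat) (w : 'I_d -> R) (t : R) :
  \sum_i w i = 0 -> \det (diag_flow w t) = 1.
Proof.
move=> w0; rewrite det_diag; under eq_bigr do rewrite mxE.
by rewrite -expR_sum -mulr_suml w0 mul0r expR0.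
Qed.

Lemma diag_flow0 (R : realType) (d : nat) (w : 'I_d -> R) : diag_flow w 0 = 1%:M.
Proof. by apply/matrixP => i j; rewrite !mxE mulr0 expR0. Qed.

Lemma diag_flowD (R : realType) (d : nat) (w : 'I_d -> R) (s t : R) :
  diag_flow w (s + t) = diag_flow w s *m diag_flow w t.
Proof.
apply/matrixP => i j; by rewrite mul_diag_mx !mxE mulrDr expRD mulrnAr.
Qed.

(** Turns a bound on a power of the systole into a bound on the systole without extracting roots. *)
Lemma min1_le_exprn (R : realType) (x a : R) (k : nat) :
  0 <= x -> a <= x ^+ k.+1 -> Num.min 1 a <= x.
Proof.
move=> x0 ax; rewrite ge_min; have [//|x1] := leP 1 x.
apply/orP; right; apply: le_trans ax _.
by rewrite exprS ler_piMr// exprn_ile1// ltW.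
Qed.

Section lagrange.
Context {R : realType} {n : nat} {eta : 'cV[R]_n.+1 -> R} (heta : is_norm eta).
Context {w : 'I_n.+1 -> R} (hsum : \sum_i w i = 0).

Let g := diag_flow w.

(** A real-valued version on basis matrices; [fine] loses nothing at determinant 1, where the liminf
    is finite by [lagrange_valueE]. *)
Definition lagrange_value (h : 'M[R]_n.+1) : R :=
  fine (lagrange_constant g eta (lattice_act h (@integer_lattice R n.+1))).

Let lagrange_constant_systole (h : 'M[R]_n.+1) :
  lagrange_constant g eta (lattice_act h (@integer_lattice R n.+1)) =
  limf_einf (fun t : R => (systole eta (g t *m h) ^+ n.+1)%:E) (+oo)%R.
Proof.
by congr limf_einf; apply/funext => t; rewrite /systole lattice_actM.
Qed.

Let det_gM (t : R) (h : 'M[R]_n.+1) : \det h = 1 -> \det (g t *m h) = 1.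
Proof. by move=> h1; rewrite det_mulmx det_diag_flow// h1 mulr1. Qed.

Let lagrange_bound : exists C : R, forall h : 'M[R]_n.+1, \det h = 1 ->
  (lagrange_constant g eta (lattice_act h (@integer_lattice R n.+1)) <= C%:E)%E.
Proof.
have [C HC] := systole_bounded heta; exists (C ^+ n.+1) => h h1.
rewrite lagrange_constant_systole leNgt; apply/negP => /limf_einf_gt/filter_ex[t].
apply/negP; rewrite -leNgt; apply: lerXn2r; rewrite ?nnegrE ?systole_ge0//.
  by apply: le_trans (HC _ h1); exact: systole_ge0.
by apply: HC; exact: det_gM.
Qed.

Lemma lagrange_valueE (h : 'M[R]_n.+1) : \det h = 1 ->
  lagrange_constant g eta (lattice_act h (@integer_lattice R n.+1)) =
  (lagrange_value h)%:E.
Proof.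
move=> h1; rewrite fineK//; have [C HC] := lagrange_bound.
rewrite ge0_fin_numE; first exact: le_lt_trans (HC h h1) (ltry _).
rewrite lagrange_constant_systole; apply: limf_einf_ge; apply: nearW => t.
by rewrite exprn_ge0// systole_ge0.
Qed.

Lemma lagrange_value_ge (h : 'M[R]_n.+1) (a : R) : \det h = 1 ->
  (\forall t \near +oo, a <= systole eta (g t *m h) ^+ n.+1) -> a <= lagrange_value h.
Proof.
move=> h1 /limf_einf_ge.
by rewrite -lagrange_constant_systole lagrange_valueE// lee_fin.
Qed.

Lemma lagrange_value_gt (h : 'M[R]_n.+1) (a : R) : \det h = 1 ->
  a < lagrange_value h -> \forall t \near +oo, a < systole eta (g t *m h) ^+ n.+1.
Proof.
move=> h1; rewrite -lte_fin -lagrange_valueE// lagrange_constant_systole.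
exact: limf_einf_gt.
Qed.

Lemma lagrange_value_ge0 (h : 'M[R]_n.+1) : \det h = 1 -> 0 <= lagrange_value h.
Proof.
by move=> h1; apply: lagrange_value_ge => //; apply: nearW => t; rewrite exprn_ge0// systole_ge0.
Qed.

(** Since [c] commutes with the flow, it acts on the whole trajectory of [h] and changes every
    systole by a factor at most [K], uniformly in time. *)
Lemma lagrange_valueM (c h : 'M[R]_n.+1) (K : R) :
  \det c = 1 -> \det h = 1 -> (forall t, c *m g t = g t *m c) -> 0 < K ->
  (forall v, eta (c *m v) <= K * eta v) ->
  lagrange_value (c *m h) <= K ^+ n.+1 * lagrange_value h.
Proof.
move=> c1 h1 cg K0 cK; have ch1 : \det (c *m h) = 1 by rewrite det_mulmx c1 mul1r.
have Kn0 : 0 < K ^+ n.+1 by exact: exprn_gt0.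
rewrite leNgt; apply/negP => lt_ch.
(* A level strictly between the two sides of the inequality to be refuted. *)
pose m := (lagrange_value h + (K ^+ n.+1)^-1 * lagrange_value (c *m h)) / 2.
have lt_h : lagrange_value h < (K ^+ n.+1)^-1 * lagrange_value (c *m h).
  by rewrite ltr_pdivlMl.
have /(lagrange_value_gt ch1) near_ch : K ^+ n.+1 * m < lagrange_value (c *m h).
  by rewrite -ltr_pdivlMl// /m; lra.
have : m <= lagrange_value h; last by rewrite /m; lra.
apply: lagrange_value_ge => //; apply: filterS near_ch => t.
rewrite mulmxA -cg -mulmxA => /lt_le_trans h_lt; apply: ltW.
rewrite -(ltr_pM2l Kn0) -exprMn; apply: h_lt.
apply: lerXn2r; rewrite ?nnegrE ?mulr_ge0 ?systole_ge0 ?(ltW K0)//.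
by apply: systoleM => //; apply: det1_unitmx => //; exact: det_gM.
Qed.

(** Almost maximal lattices are pushed along the flow until their lower bound holds at all
    nonnegative times; a Mahler limit then inherits the bound [sup S] at each time. *)
Lemma lagrange_value_max : exists2 h : 'M[R]_n.+1, \det h = 1 &
  forall h' : 'M[R]_n.+1, \det h' = 1 -> lagrange_value h' <= lagrange_value h.
Proof.
pose S := [set lagrange_value h | h in [set h : 'M[R]_n.+1 | \det h = 1]].
have S0 : S !=set0 by exists (lagrange_value 1%:M), 1%:M => //=; exact: det1.
have supS : has_sup S.
  split=> //; have [C HC] := lagrange_bound; exists C => _ [h h1 <-].
  by rewrite -lee_fin -lagrange_valueE//; exact: HC.
have le_sup (h : 'M[R]_n.+1) : \det h = 1 -> lagrange_value h <= sup S.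
  by move=> h1; apply: ub_le_sup; [case: supS | exists h].
suff [h h1 hS] : exists2 h : 'M[R]_n.+1, \det h = 1 & sup S <= lagrange_value h.
  by exists h => // h' h'1; apply: le_trans hS; exact: le_sup.
(* Mahler compactness needs a positive lower bound; if the supremum is not positive, any lattice
   attains it. *)
have [L0|L0] := lerP (sup S) 0.
  by exists 1%:M; rewrite ?det1// (le_trans L0)// lagrange_value_ge0 ?det1.
have near_sup (m : nat) : exists y : 'M[R]_n.+1, \det y = 1 /\
    forall t, 0 <= t -> sup S - harmonic m < systole eta (g t *m y) ^+ n.+1.
  have [_ [y y1 <-]] := sup_adherent (harmonic_gt0 m) supS.
  move=> /(lagrange_value_gt y1)[T [Tr HT]].
  (* The bound is known strictly beyond [T], hence the shift by [T + 1]. *)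
  exists (g (T + 1) *m y); split=> [|t t0]; first exact: det_gM.
  by rewrite mulmxA -diag_flowD; apply: HT; lra.
have [y yP] := choice near_sup.
have [U [UU oU]] := @ultraFilterLemma _ \oo _.
have Up : ProperFilter U by exact: ultra_proper.
have Uharm : @harmonic R @ U --> (0 : R).
  by apply: cvg_trans (@cvg_harmonic R); exact: cvg_app.
(* For [U]-most [m] the error is at most half of the supremum, which bounds the systole of [y m]
   itself, at time 0. *)
pose e := Num.min 1 (sup S / 2).
have e0 : 0 < e by rewrite lt_min ltr01 divr_gt0.
have [||A [h [A1 h1 Ah]]] := @mahler_compactness _ _ _ heta _ U y e UU e0.
- by move=> m; have [] := yP m.
- have : \forall m \near U, harmonic m <= sup S / 2.
    by apply: (cvgr_le 0) => //; rewrite divr_gt0.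
  apply: filterS => m hm; have [_ /(_ 0 (lexx _))] := yP m.
  rewrite [g 0]diag_flow0 mul1mx.
  move=> hs; apply: (@min1_le_exprn _ _ _ n); first exact: systole_ge0.
  lra.
exists h => //; apply: lagrange_value_ge => //; exists 0; split=> // t t0.
apply: le_systoleX => //; first by apply: det1_unitmx; exact: det_gM.
move=> v v0.
(* For fixed [t] and [v] the bound passes to the limit, because [int_mx (A m)] only changes the
   basis of the lattice of [y m]. *)
have lim1 : eta (g t *m (y m *m int_mx (A m)) *m int_mx v) ^+ n.+1 @[m --> U]
    --> eta (g t *m h *m int_mx v) ^+ n.+1.
  apply: cvg_exprn; apply: norm_cvg => //.
  by apply: mx_cvgM; [apply: mx_cvgM => //|]; exact: mx_cvg_cst.
have lim2 : sup S - harmonic m @[m --> U] --> sup S - 0.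
  by apply: cvgB => //; exact: cvg_cst.
rewrite -[leLHS]subr0; apply: (ler_cvg_to lim2 lim1); apply: nearW => m.
have [y1 yt] := yP m; apply: le_trans (ltW (yt t (ltW t0))) _.
apply: lerXn2r; rewrite ?nnegrE ?systole_ge0 ?norm_ge0//.
rewrite -!mulmxA -int_mxM mulmxA; apply: systole_le => //.
  by apply: det1_unitmx; exact: det_gM.
by rewrite unitmx_mul_eq0// det1_unitmx.
Qed.

End lagrange.

(** * Contracting a plane in the centralizer of the flow *)

Lemma sum_indic (R : pzRingType) (n : nat) (k : 'I_n) : \sum_l (l == k)%:R = 1 :> R.
Proof. by rewrite (bigD1 k)//= eqxx big1 ?addr0// => l /negPf ->. Qed.

Section contraction.
Context {R : realType} {n : nat} (i j : 'I_n.+1) (p : R) (ij : i != j).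

Definition shear (q : R) : 'M[R]_n.+1 := 1%:M + q *: delta_mx i j.

(* One-parameter group contracting the line spanned by -p e_i + e_j in the
   (i, j)-plane and fixing the other coordinates *)
Definition contraction (r : R) : 'M[R]_n.+1 :=
  shear (- p) *m diag_flow (fun k => (k == i)%:R - (k == j)%:R) r *m shear p.

Lemma shearE (q : R) (v : 'cV[R]_n.+1) (k : 'I_n.+1) :
  (shear q *m v) k 0 = v k 0 + (k == i)%:R * (q * v j 0).
Proof.
rewrite mulmxDl mul1mx -scalemxAl !mxE; congr (_ + _).
rewrite (bigD1 j)//= big1 => [|l lj]; last by rewrite !mxE (negPf lj) andbF mul0r.
by rewrite !mxE eqxx andbT addr0 mulrCA.
Qed.

Lemma shearD (q r : R) : shear q *m shear r = shear (q + r).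
Proof.
rewrite /shear mulmxDl mul1mx mulmxDr mulmx1 -scalemxAl -scalemxAr.
rewrite mul_delta_mx_0 1?eq_sym// !scaler0 addr0 -addrA; congr (_ + _).
by rewrite addrC scalerDl.
Qed.

Lemma shear0 : shear 0 = 1%:M.
Proof. by rewrite /shear scale0r addr0. Qed.

Lemma contractionD (r s : R) : contraction (r + s) = contraction r *m contraction s.
Proof.
rewrite /contraction diag_flowD !mulmxA; congr (_ *m _ *m _).
by rewrite -[_ *m shear p *m _]mulmxA shearD subrr shear0 mulmx1.
Qed.

Lemma contraction0 : contraction 0 = 1%:M.
Proof. by rewrite /contraction diag_flow0 mulmx1 shearD addNr shear0. Qed.

Lemma det_contraction (r : R) : \det (contraction r) = 1.
Proof.
rewrite !det_mulmx mulrAC -det_mulmx shearD addNr shear0 det1 mul1r.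
by apply: det_diag_flow; rewrite sumrB !sum_indic subrr.
Qed.

Lemma contraction_cvg : mx_cvg (nbhs (0 : R)) contraction 1%:M.
Proof.
rewrite -contraction0; apply: mx_cvgM; last exact: mx_cvg_cst.
apply: mx_cvgM; first exact: mx_cvg_cst.
move=> k l; rewrite !mxE; under eq_fun do rewrite !mxE.
case: (k == l); last by under eq_fun do rewrite mulr0n; rewrite mulr0n; exact: cvg_cst.
under eq_fun do rewrite mulr1n; rewrite mulr1n.
by apply: continuous_cvg; [exact: continuous_expR | apply: cvgMr; exact: cvg_id].
Qed.

(** Equal weights make the flow scalar on the plane of coordinates [i] and [j], so it commutes with
    the shears; diagonal matrices commute anyway. *)
Lemma contraction_diag_flow (w : 'I_n.+1 -> R) (r t : R) : w i = w j ->
  contraction r *m diag_flow w t = diag_flow w t *m contraction r.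
Proof.
move=> wij; have sh q : shear q *m diag_flow w t = diag_flow w t *m shear q.
  apply/matrixP => k l; rewrite mul_mx_diag mul_diag_mx !mxE mulrC.
  have [->//|kl] := eqVneq k l.
  have [/andP[/eqP -> /eqP ->]|] := boolP ((k == i) && (l == j)); first by rewrite wij.
  by rewrite !mulr0 addr0 mulr0n !mulr0.
rewrite /contraction -mulmxA sh !mulmxA -(sh (- p)); congr (_ *m _).
by rewrite -!mulmxA; congr (_ *m _); exact: diag_mx_comm.
Qed.

(** The hypothesis says that the planar part of [v] lies on the contracted line. *)
Lemma contractionE (r : R) (v : 'cV[R]_n.+1) (k : 'I_n.+1) :
  v i 0 + p * v j 0 = 0 ->
  (contraction r *m v) k 0 = if (k == i) || (k == j) then expR (- r) * v k 0 else v k 0.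
Proof.
move=> vij; have uE := shearE p v; rewrite /contraction -!mulmxA shearE.
move: (shear p *m v) uE => u uE; rewrite !mul_diag_mx !mxE !uE !eqxx.
have [->|ki] := eqVneq k i.
  rewrite (eq_sym j) (negPf ij) /= !mul1r vij mulr0 add0r !mul0r addr0 sub0r mulN1r.
  have -> : v i 0 = - (p * v j 0) by apply/eqP; rewrite -addr_eq0 vij.
  by ring.
have [->|kj] := eqVneq k j; rewrite /= !mul0r !addr0 ?sub0r ?subr0 ?mulN1r//.
by rewrite oppr0 mul0r expR0 mul1r.
Qed.

End contraction.

(* Minkowski's theorem applied after expanding the other coordinates *)
Lemma minkowski_flat_vector (R : realType) (n : nat) (g : 'M[R]_n.+1)
    (i j : 'I_n.+1) (e : R) : \det g = 1 -> 0 < e ->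
  exists2 v : 'cV[int]_n.+1, v != 0 &
    forall k, k != i -> k != j -> `|(g *m int_mx v) k 0| <= e.
Proof.
move=> g1 e0; have [C HC] := @minkowski_short_vector R n.
(* Weight 2 on the coordinates to be made small, balanced on [i] and [j] so that the total is
   zero. *)
pose w (k : 'I_n.+1) : R := 2 - n.+1%:R * ((k == i)%:R + (k == j)%:R).
have w0 : \sum_k w k = 0.
  rewrite sumrB sumr_const card_ord -mulr_sumr big_split /= !sum_indic -mulr_natr; ring.
(* Chosen so that [expR (2 * s) >= s] yields [C <= e * expR (2 * s)]. *)
pose s := `|C| / e.
have [|v v0 vC] := HC (diag_flow w s *m g).
  by rewrite det_mulmx g1 mulr1 det_diag_flow.
exists v => // k ki kj; have := vC k.
rewrite -mulmxA mul_diag_mx !mxE /w (negPf ki) (negPf kj) addr0 mulr0 subr0.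
rewrite normrM ger0_norm ?expR_ge0// => kC.
have s0 : 0 <= s by rewrite divr_ge0 ?(ltW e0).
have es : s <= expR (2 * s) by have := expR_ge1Dx (2 * s); lra.
have exp1 : 1 <= expR (2 * s) by have := expR_ge1Dx (2 * s); lra.
have Ce : C <= e * expR (2 * s).
  by rewrite mulrC -ler_pdivrMr//; apply: le_trans es; rewrite ler_pM2r ?invr_gt0// ler_norm.
by rewrite -(ler_pM2l (expR_gt0 (2 * s))); apply: le_trans kC _; rewrite mulrC.
Qed.

Lemma expR_small (R : realType) (a e : R) : 0 < e -> exists2 r, 0 <= r & expR (- r) * a <= e.
Proof.
move=> e0; exists (`|a| / e); first by rewrite divr_ge0// ltW.
rewrite expRN mulrC ler_pdivrMr ?expR_gt0//.
apply: le_trans (ler_norm a) _; rewrite mulrC -ler_pdivrMr//.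
by have := expR_ge1Dx (`|a| / e); lra.
Qed.

(** * Small values, continuity along the contraction, and the value at the integer lattice *)

Section main.
Context {R : realType} {n : nat} {eta : 'cV[R]_n.+1 -> R} (heta : is_norm eta).
Context {w : 'I_n.+1 -> R} (hsum : \sum_i w i = 0).

Let g := diag_flow w.
Let value := @lagrange_value R n eta w.

(** Positivity of the value keeps the trajectory in a compact set, so it has a limit lattice [y]. A
    contraction shortening a flat vector of [y] also shortens nearby vectors of the trajectory, at
    arbitrarily late times. *)
Lemma lagrange_value_small (h : 'M[R]_n.+1) (i0 j0 : 'I_n.+1) (l : R) :
  i0 != j0 -> w i0 = w j0 -> \det h = 1 -> 0 < value h -> 0 < l ->
  exists i j p, [/\ i != j, w i = w j &
    exists2 r, 0 <= r & value (contraction i j p r *m h) <= l].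
Proof.
move=> ij0 wij0 h1 h0 l0.
have [U [UU oU]] := @ultraFilterLemma _ (pinfty_nbhs R) _.
have Up : ProperFilter U by exact: ultra_proper.
have gh1 t : \det (g t *m h) = 1 by rewrite det_mulmx h1 mulr1 det_diag_flow.
pose e := Num.min 1 (value h / 2).
have e0 : 0 < e by rewrite lt_min ltr01 divr_gt0.
have Ue : \forall t \near U, e <= systole eta (g t *m h).
  have : \forall t \near +oo, value h / 2 < systole eta (g t *m h) ^+ n.+1.
    by apply: lagrange_value_gt => //; rewrite -/value; lra.
  move=> /oU; apply: filterS => t /ltW.
  by apply: min1_le_exprn; exact: systole_ge0.
have [A [y [A1 y1 Ay]]] := mahler_compactness heta UU e0 gh1 Ue.
have [B B0 HB] := norm_le_entries heta.
pose f := Num.min 1 l.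
have f0 : 0 < f by rewrite lt_min ltr01.
have fl : f ^+ n.+1 <= l.
  apply: (@le_trans _ _ f); last by rewrite ge_min lexx orbT.
  by rewrite exprS ler_piMr ?(ltW f0)// exprn_ile1 ?(ltW f0)// ge_min lexx.
(* Entries bounded by [q] give norm at most [B * q = f / 2], strictly below [f]. *)
pose q := f / (2 * B).
have q0 : 0 < q by rewrite divr_gt0// mulr_gt0.
have [v v0 vq] := minkowski_flat_vector i0 j0 y1 q0.
set u := y *m int_mx v in vq.
(* The slope [p] places the planar part of [u] on the contracted line. That line is never the
   [i]-axis, so the two indices are exchanged when [u j0 0] vanishes. *)
have [i [j [p [ij wij [uij ukij]]]]] : exists i j p, [/\ i != j, w i = w j &
    u i 0 + p * u j 0 = 0 /\ forall k, k != i -> k != j -> `|u k 0| <= q].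
  have [uj|uj] := eqVneq (u j0 0) 0.
    exists j0, i0, 0; rewrite eq_sym ij0 mul0r addr0; split=> //; split=> //.
    by move=> k kj ki; exact: vq.
  exists i0, j0, (- u i0 0 / u j0 0); split=> //; split=> //.
  by rewrite mulfVK// subrr.
exists i, j, p; split=> //.
have [r r0 rq] := expR_small (`|u i 0| + `|u j 0|) q0.
exists r => //; set c := contraction i j p r.
have cu : eta (c *m u) < f.
  apply: (@le_lt_trans _ _ (B * q)).
    apply: HB => k; rewrite /c contractionE//.
    have E0 := expR_ge0 (- r).
    case: ifPn => [|/norP[ki kj]]; last exact: ukij.
    rewrite normrM (ger0_norm E0) => kij; apply: le_trans rq.
    apply: ler_wpM2l => //.
    by case/orP: kij => /eqP ->; rewrite ?lerDl ?lerDr.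
  have -> : B * q = f / 2 by rewrite /q; field; rewrite gt_eqF.
  by lra.
have c1 : \det c = 1 by exact: det_contraction.
have lim : eta (c *m (g t *m h *m int_mx (A t)) *m int_mx v) @[t --> U] --> eta (c *m u).
  apply: norm_cvg => //; rewrite /u mulmxA; apply: mx_cvgM; last exact: mx_cvg_cst.
  by apply: mx_cvgM => //; exact: mx_cvg_cst.
have Uf : \forall t \near U, eta (c *m (g t *m h *m int_mx (A t)) *m int_mx v) < f.
  exact: (cvgr_lt _ lim).
(* A value above [l] would keep the power of the systole above [l] at all late times, while at
   [U]-many of them it is at most [f ^+ n.+1 <= l]. *)
rewrite leNgt; apply/negP => lc.
have ch1 : \det (c *m h) = 1 by rewrite det_mulmx c1 mul1r.
have /oU Ul : \forall t \near +oo, l < systole eta (g t *m (c *m h)) ^+ n.+1.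
  exact: lagrange_value_gt.
have [t [/= tf tl]] := filter_ex (filterI Uf Ul).
suff : systole eta (g t *m (c *m h)) ^+ n.+1 <= f ^+ n.+1 by lra.
apply: lerXn2r; rewrite ?nnegrE ?systole_ge0 ?(ltW f0)//.
apply: le_trans (ltW tf); rewrite mulmxA -contraction_diag_flow// -mulmxA.
have -> : c *m (g t *m h *m int_mx (A t)) *m int_mx v =
    c *m (g t *m h) *m int_mx (A t *m v) by rewrite int_mxM !mulmxA.
apply: systole_le => //.
  by rewrite det1_unitmx// det_mulmx c1 mul1r gh1.
by rewrite unitmx_mul_eq0// det1_unitmx.
Qed.

(** The group law reduces continuity at [r] to the distortion [K] of the contraction near parameter
    0, where [K] tends to 1. *)
Lemma lagrange_value_continuous (h : 'M[R]_n.+1) (i j : 'I_n.+1) (p : R) :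
  i != j -> w i = w j -> \det h = 1 ->
  continuous (fun r => value (contraction i j p r *m h)).
Proof.
move=> ij wij h1 r; have [B [B0 HB]] := norm_mulmx_near1 heta.
pose c := contraction i j p.
pose K x := 1 + B * \sum_a \sum_b `|c x a b - (1%:M : 'M[R]_n.+1) a b|.
have S0 x : 0 <= \sum_a \sum_b `|c x a b - (1%:M : 'M[R]_n.+1) a b|.
  by apply: sumr_ge0 => a _; exact: sumr_ge0.
have K0 x : 0 < K x by rewrite ltr_wpDr// mulr_ge0.
have Kcvg (s : R -> R) : s @ r --> (0 : R) -> K (s x) ^+ n.+1 @[x --> r] --> (1 : R).
  move=> s0; rewrite -(expr1n _ n.+1); apply: cvg_exprn; apply: (cvg_comp _ K s0).
  pose I1 : 'M[R]_n.+1 := 1%:M.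
  have <- : 1 + B * \sum_a \sum_b `|I1 a b - I1 a b| = 1.
    by rewrite big1 ?mulr0 ?addr0// => a _; rewrite big1// => b _; rewrite subrr normr0.
  apply: cvgD; first exact: cvg_cst.
  apply: cvgMr; apply: cvg_sumr => a; apply: cvg_sumr => b; apply: cvg_norm.
  by apply: cvgB; [exact: contraction_cvg | exact: cvg_cst].
(* Used with [(x, r)] and with [(r, x)], this gives both sides of the squeeze. *)
have vK x z : value (c x *m h) <= K (x - z) ^+ n.+1 * value (c z *m h).
  have -> : c x *m h = c (x - z) *m (c z *m h).
    by rewrite mulmxA /c -contractionD// subrK.
  apply: lagrange_valueM => //.
  - exact: det_contraction.
  - by rewrite det_mulmx det_contraction// mul1r.
  - by move=> t; exact: contraction_diag_flow.
have lower : (K (r - x) ^+ n.+1)^-1 * value (c r *m h) @[x --> r] --> value (c r *m h).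
  rewrite -[X in _ --> X]mul1r -[X in X * _]invr1; apply: cvgMl; apply: cvgV => //.
  apply: (Kcvg (fun x => r - x)); rewrite -(subrr r).
  by apply: cvgB; [exact: cvg_cst | exact: cvg_id].
have upper : K (x - r) ^+ n.+1 * value (c r *m h) @[x --> r] --> value (c r *m h).
  rewrite -[X in _ --> X]mul1r; apply: cvgMl.
  apply: (Kcvg (fun x => x - r)); rewrite -(subrr r).
  by apply: cvgB; [exact: cvg_id | exact: cvg_cst].
apply: squeeze_cvgr lower upper; apply: nearW => x.
by rewrite vK andbT ler_pdivrMl ?exprn_gt0.
Qed.

(** Weights of sum zero that are not all zero include a negative one, and the corresponding unit
    vector is contracted to 0 by the flow. *)
Lemma lagrange_value_int : (exists i, w i != 0) -> value 1%:M = 0.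
Proof.
move=> [k0 wk0].
have [k wk] : exists k, w k < 0.
  apply: contrapT => nok; move/eqP: wk0; apply.
  apply: (psumr_eq0P _ hsum) => // k _; rewrite leNgt; apply/negP => wk.
  by apply: nok; exists k.
have d1 : \det (1%:M : 'M[R]_n.+1) = 1 by exact: det1.
apply/eqP; rewrite eq_le lagrange_value_ge0// andbT leNgt; apply/negP => v0.
pose q := Num.min 1 (value 1%:M / 2).
have q0 : 0 < q by rewrite lt_min ltr01 divr_gt0.
have /(lagrange_value_gt heta hsum d1)[T [_ HT]] : value 1%:M / 2 < value 1%:M by lra.
pose a := eta (delta_mx k 0).
have a0 : 0 <= a by exact: norm_ge0.
have qw0 : 0 < q * - w k by rewrite mulr_gt0// oppr_gt0.
(* Beyond [T], and late enough that [q * (- w k * t) >= a]; then [1 + x <= expR x] gives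
   [a < q * expR (- w k * t)]. *)
pose t := `|T| + 1 + a / (q * - w k).
have tT : T < t.
  have : 0 <= a / (q * - w k) by rewrite divr_ge0// ltW.
  by have := ler_norm T; rewrite /t; lra.
have := min1_le_exprn (systole_ge0 heta _) (ltW (HT t tT)).
rewrite -/q leNgt => /negP; apply.
apply: (@le_lt_trans _ _ (eta (g t *m 1%:M *m int_mx (delta_mx k 0)))).
  apply: systole_le => //.
    by apply: det1_unitmx; rewrite mulmx1 det_diag_flow.
  by apply/eqP => /matrixP/(_ k 0); rewrite !mxE !eqxx.
have -> : g t *m 1%:M *m int_mx (delta_mx k 0) =
    expR (w k * t) *: delta_mx k 0 :> 'cV[R]_n.+1.
  apply/matrixP => x y; rewrite mulmx1 mul_diag_mx /int_mx map_delta_mx !mxE.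
  by have [->//|] := eqVneq x k; rewrite !mulr0.
rewrite (is_normZ heta) ger0_norm ?expR_ge0// -/a.
have -> : w k * t = - (- w k * t) by rewrite mulNr opprK.
rewrite expRN mulrC ltr_pdivrMr ?expR_gt0//.
apply: (@le_lt_trans _ _ (q * (- w k * t))); last first.
  by rewrite ltr_pM2l//; have := expR_ge1Dx (- w k * t); lra.
have -> : q * (- w k * t) = q * - w k * (`|T| + 1) + a.
  by rewrite mulrA /t mulrDr [X in _ + X]mulrCA mulfV ?mulr1// gt_eqF.
by rewrite lerDr mulr_ge0 ?(ltW qw0)// addr_ge0.
Qed.

End main.

Theorem theorem1p3 (R : realType) (d : nat) (eta : 'cV[R]_d -> R)
    (w : 'I_d -> R) (heta : is_norm eta)
    (hsum : \sum_(i < d) w i = 0)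
    (hnz : exists i : 'I_d, w i != 0)
    (heq : exists i j : 'I_d, i != j /\ w i = w j) :
  lagrange_spectrum (diag_flow w) eta =
    [set l%:E | l in `[0, fine (lagrange_sup (diag_flow w) eta)]].
Proof.
have [i0 [j0 [ij0 wij0]]] := heq.
(* Dimension 0 is excluded because an index exists. *)
case: d eta w heta hsum hnz heq i0 j0 ij0 wij0 => [|n] eta w heta hsum hnz _ i0 j0 ij0 wij0.
  by have := ltn_ord i0.
pose value := @lagrange_value R n eta w.
have [h h1 hmax] := lagrange_value_max heta hsum.
have spectrumE : lagrange_spectrum (diag_flow w) eta =
    [set (value g)%:E | g in [set g : 'M[R]_n.+1 | \det g = 1]].
  apply/seteqP; split => [_ [_ [g g1 <-] <-]|_ [g g1 <-]].
    by exists g => //; rewrite -(lagrange_valueE heta hsum g1).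
  exists (lattice_act g (@integer_lattice R n.+1)); first by exists g.
  exact: lagrange_valueE.
have -> : lagrange_sup (diag_flow w) eta = (value h)%:E.
  rewrite /lagrange_sup spectrumE; apply/eqP; rewrite eq_le; apply/andP; split.
    by apply: ge_ereal_sup => _ [g g1 <-]; rewrite lee_fin; exact: hmax.
  by apply: ereal_sup_ubound; exists h.
rewrite spectrumE; apply/seteqP; split => [_ [g g1 <-]|_ [l + <-]].
  exists (value g) => //=; rewrite in_itv /= hmax// andbT.
  exact: lagrange_value_ge0.
rewrite /= in_itv /= => /andP[l0 lh].
have [->|l_neq0] := eqVneq l 0.
  by exists 1%:M; [exact: det1 | rewrite /value lagrange_value_int].
have l_gt0 : 0 < l by rewrite lt_neqAle eq_sym l_neq0.
have [i [j [p [ij wij [r r0 rl]]]]] :=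
  lagrange_value_small heta hsum ij0 wij0 h1 (lt_le_trans l_gt0 lh) l_gt0.
have cont : continuous (fun r => value (contraction i j p r *m h)).
  exact: lagrange_value_continuous.
(* At parameter 0 the value is that of the maximiser [h], at least [l]; at [r] it is at most [l]. *)
have [|s _ <-] := @IVT R _ 0 r l r0 (continuous_subspaceT cont).
  by rewrite (contraction0 p ij) mul1mx ge_min le_max rl lh orbT.
exists (contraction i j p s *m h) => //=.
by rewrite det_mulmx det_contraction// mul1r.
Qed.
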